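(* Let $P$, $Q$, $R$ be Interface Automata with common input alphabet $I$ and common output alphabet $O$, where $P$ and $Q$ have disjoint state sets, and let $p\in P$, $q\in Q$, $r\in R$. Then $p\vee q\sqsubseteq_{\mathrm{IA}} r$ if and only if $p\sqsubseteq_{\mathrm{IA}} r$ and $q\sqsubseteq_{\mathrm{IA}} r$, where $p\vee q$ is the corresponding state of the IA-disjunction $P\vee Q$.
   Context: An Interface Automaton (IA) is a tuple $P=(P,I,O,\rightarrow_P)$ where $P$ is a set of states, $I$ and $O$ are disjoint sets of input and output actions not containing the special silent action $\tau$, and $\rightarrow_P\subseteq P\times(I\cup O\cup\{\tau\})\times P$ is input-deterministic: for $a\in I$, $p\xrightarrow{a}p'$ and $p\xrightarrow{a}p''$ imply $p'=p''$. Weak transitions: $p\stackrel{\epsilon}{\Rightarrow}p'$ iff $p(\xrightarrow{\tau})^*p'$; for $o\in O$, $p\stackrel{o}{\Rightarrow}p'$ iff there is $p''$ with $p\stackrel{\epsilon}{\Rightarrow}p''\xrightarrow{o}p'$; $\hat\alpha=\epsilon$ if $\alpha=\tau$ and $\hat\alpha=\alpha$ otherwise. For IAs $P,Q$ with the same alphabets, $\mathcal R\subseteq P\times Q$ is an alternating simulation if for all $(p,q)\in\mathcal R$: (i) $q\xrightarrow{a}q'$ with $a\in I$ implies some $p'$ with $p\xrightarrow{a}p'$ and $(p',q')\in\mathcal R$; (ii) $p\xrightarrow{\alpha}p'$ with $\alpha\in O\cup\{\tau\}$ implies some $q'$ with $q\stackrel{\hat\alpha}{\Rightarrow}q'$ and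 $(p',q')\in\mathcal R$. Write $p\sqsubseteq_{\mathrm{IA}}q$ if some alternating simulation contains $(p,q)$. IA-disjunction: for IAs $P=(P,I,O,\rightarrow_P)$, $Q=(Q,I,O,\rightarrow_Q)$ with disjoint state sets, $P\vee Q$ is the IA with state set $\{p\vee q: p\in P,q\in Q\}\cup P\cup Q$, alphabets $I,O$, and the least transition relation containing $\rightarrow_P$ and $\rightarrow_Q$ and satisfying: (I) $p\vee q\xrightarrow{a}p'\vee q'$ if $p\xrightarrow{a}_Pp'$, $q\xrightarrow{a}_Qq'$ and $a\in I$; (OT1) $p\vee q\xrightarrow{\alpha}p'$ if $p\xrightarrow{\alpha}_Pp'$ and $\alpha\in O\cup\{\tau\}$; (OT2) $p\vee q\xrightarrow{\alpha}q'$ if $q\xrightarrow{\alpha}_Qq'$ and $\alpha\in O\cup\{\tau\}$. *)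

(* Defs.v *)
(* Plain Stdlib development. *)
From Stdlib Require Import Relations.

Set Implicit Arguments.
Unset Strict Implicit.
Unset Printing Implicit Defensive.

(* The alphabets are types I and O; that they are disjoint and do not contain
   the silent action is built into the three distinct constructors. *)
Inductive action (I O : Type) : Type :=
| Inp (a : I)
| Out (o : O)
| Tau.

Arguments Inp {I O} a.
Arguments Out {I O} o.
Arguments Tau {I O}.

(* alpha \in O \cup {tau} *)
Definition is_local (I O : Type) (alpha : action I O) : Prop :=
  match alpha with
  | Inp _ => False
  | Out _ | Tau => True
  end.

Record IA (I O : Type) : Type := MkIA {
  state : Type;
  trans : state -> action I O -> state -> Prop;
  input_det : forall (a : I) (p p' p'' : state),
    trans p (Inp a) p' -> trans p (Inp a) p'' -> p' = p''
}.

(* The label epsilon of weak transitions is None. *)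
Definition hat (I O : Type) (alpha : action I O) : option (action I O) :=
  match alpha with
  | Tau => None
  | _ => Some alpha
  end.

(* Only used for w = None and w = Some (Out o). *)
Definition weak (I O : Type) (P : IA I O) (w : option (action I O))
    (p p' : state P) : Prop :=
  let eps := clos_refl_trans (state P) (fun x y => trans x Tau y) in
  match w with
  | None => eps p p'
  | Some alpha => exists p'' : state P, eps p p'' /\ trans p'' alpha p'
  end.

Definition alternating_simulation (I O : Type) (P Q : IA I O)
    (S : state P -> state Q -> Prop) : Prop :=
  forall (p : state P) (q : state Q), S p q ->
    (forall (a : I) (q' : state Q), trans q (Inp a) q' ->
       exists p' : state P, trans p (Inp a) p' /\ S p' q')
    /\
    (forall (alpha : action I O) (p' : state P),
       is_local alpha -> trans p alpha p' ->
       exists q' : state Q, weak (hat alpha) q q' /\ S p' q').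

Definition IA_refines (I O : Type) (P Q : IA I O)
    (p : state P) (q : state Q) : Prop :=
  exists S : state P -> state Q -> Prop, alternating_simulation S /\ S p q.

(* {p \/ q} \cup P \cup Q; the constructors keep the copies of P and Q
   disjoint. *)
Inductive disj_state (A B : Type) : Type :=
| DOr (p : A) (q : B)
| DLeft (p : A)
| DRight (q : B).

Arguments DOr {A B} p q.
Arguments DLeft {A B} p.
Arguments DRight {A B} q.

Inductive disj_trans (I O : Type) (P Q : IA I O) :
    disj_state (state P) (state Q) -> action I O ->
    disj_state (state P) (state Q) -> Prop :=
| disj_P (p p' : state P) (alpha : action I O) :
    trans p alpha p' -> disj_trans (DLeft p) alpha (DLeft p')
| disj_Q (q q' : state Q) (alpha : action I O) :
    trans q alpha q' -> disj_trans (DRight q) alpha (DRight q')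
| disj_I (p p' : state P) (q q' : state Q) (a : I) :
    trans p (Inp a) p' -> trans q (Inp a) q' ->
    disj_trans (DOr p q) (Inp a) (DOr p' q')
| disj_OT1 (p p' : state P) (q : state Q) (alpha : action I O) :
    is_local alpha -> trans p alpha p' ->
    disj_trans (DOr p q) alpha (DLeft p')
| disj_OT2 (p : state P) (q q' : state Q) (alpha : action I O) :
    is_local alpha -> trans q alpha q' ->
    disj_trans (DOr p q) alpha (DRight q').

Lemma disj_input_det (I O : Type) (P Q : IA I O) (a : I)
    (s s' s'' : disj_state (state P) (state Q)) :
  disj_trans s (Inp a) s' -> disj_trans s (Inp a) s'' -> s' = s''.
Proof.
intros H1 H2.
inversion H1; subst; inversion H2; subst; simpl in *; try contradiction;
  f_equal; eapply input_det; eassumption.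
Qed.

Definition IA_disj (I O : Type) (P Q : IA I O) : IA I O :=
  MkIA (@disj_input_det I O P Q).

Definition vee (I O : Type) (P Q : IA I O) (p : state P) (q : state Q) :
    state (IA_disj P Q) :=
  DOr p q.

(* Main.v *)
Require Import Defs.

(** At [DOr p q] inputs are synchronised, while a local step of either component resolves the
    disjunction to that component. So [r] may demand an input exactly when both components offer it,
    and must match the local steps of both: these are the conditions for [p] and [q] separately.
    Weak transitions occur only in [R], so the matching moves are reused as they are.
    [IA_refines_vee_l] and [IA_refines_vee_r] project a simulation to one component;
    [IA_refines_vee] glues two simulations. *)

Lemma IA_refines_vee_l (I O : Type) (P Q R : IA I O)
    (p : state P) (q : state Q) (r : state R) :
  IA_refines (vee p q) r -> IA_refines p r.
Proof.
intros [S [HS Hpqr]].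
(* The partner [y] is existential because each input moves it along; [DLeft x] covers the states
   after a local step. *)
exists (fun x z => S (DLeft x) z \/ exists y, S (DOr x y) z).
split; [|right; exists q; exact Hpqr].
intros x z [H | [y H]]; destruct (HS _ _ H) as [Hin Hloc]; split.
- intros a z' Hz; destruct (Hin _ _ Hz) as [s [Hs Hsz]].
  inversion Hs; subst; eauto.
- intros alpha x' Hal Hx.
  destruct (Hloc alpha (DLeft x') Hal (disj_P _ Hx)) as [z' [Hz Hsz]]; eauto.
- intros a z' Hz; destruct (Hin _ _ Hz) as [s [Hs Hsz]].
  (* Only [disj_I] survives, since [is_local] fails on inputs; its target supplies the new
     partner. *)
  inversion Hs; subst; simpl in *; try contradiction; eauto.
- intros alpha x' Hal Hx.
  destruct (Hloc alpha (DLeft x') Hal (disj_OT1 y Hal Hx)) as [z' [Hz Hsz]].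
  eauto.
Qed.

Lemma IA_refines_vee_r (I O : Type) (P Q R : IA I O)
    (p : state P) (q : state Q) (r : state R) :
  IA_refines (vee p q) r -> IA_refines q r.
Proof.
intros [S [HS Hpqr]].
exists (fun y z => S (DRight y) z \/ exists x, S (DOr x y) z).
split; [|right; exists p; exact Hpqr].
intros y z [H | [x H]]; destruct (HS _ _ H) as [Hin Hloc]; split.
- intros a z' Hz; destruct (Hin _ _ Hz) as [s [Hs Hsz]].
  inversion Hs; subst; eauto.
- intros alpha y' Hal Hy.
  destruct (Hloc alpha (DRight y') Hal (disj_Q _ Hy)) as [z' [Hz Hsz]]; eauto.
- intros a z' Hz; destruct (Hin _ _ Hz) as [s [Hs Hsz]].
  inversion Hs; subst; simpl in *; try contradiction; eauto.
- intros alpha y' Hal Hy.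
  destruct (Hloc alpha (DRight y') Hal (disj_OT2 x Hal Hy)) as [z' [Hz Hsz]].
  eauto.
Qed.

Lemma IA_refines_vee (I O : Type) (P Q R : IA I O)
    (p : state P) (q : state Q) (r : state R) :
  IA_refines p r -> IA_refines q r -> IA_refines (vee p q) r.
Proof.
intros [S [HS Hpr]] [T [HT Hqr]].
(* An unresolved state needs both simulations, as it must answer inputs in both components at
   once. *)
exists (fun s z => match s with
                   | DOr x y => S x z /\ T y z
                   | DLeft x => S x z
                   | DRight y => T y z
                   end).
split; [|exact (conj Hpr Hqr)].
intros [x y|x|y] z.
- intros [Hx Hy].
  destruct (HS _ _ Hx) as [Sin Sloc]; destruct (HT _ _ Hy) as [Tin Tloc].
  split.
  + intros a z' Hz.
    destruct (Sin _ _ Hz) as [x' [Hx' Sx']].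
    destruct (Tin _ _ Hz) as [y' [Hy' Ty']].
    exists (DOr x' y'); split; [exact (disj_I Hx' Hy') | split; assumption].
  + intros alpha s Hal Hs.
    (* A local step comes from [disj_OT1] or [disj_OT2], and the simulation of the component that
       moved answers it. *)
    inversion Hs; subst; simpl in *; try contradiction; eauto.
- intros Hx; destruct (HS _ _ Hx) as [Sin Sloc]; split.
  + intros a z' Hz; destruct (Sin _ _ Hz) as [x' [Hx' Sx']].
    exists (DLeft x'); split; [exact (disj_P _ Hx') | exact Sx'].
  + intros alpha s Hal Hs; inversion Hs; subst; eauto.
- intros Hy; destruct (HT _ _ Hy) as [Tin Tloc]; split.
  + intros a z' Hz; destruct (Tin _ _ Hz) as [y' [Hy' Ty']].
    exists (DRight y'); split; [exact (disj_Q _ Hy') | exact Ty'].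
  + intros alpha s Hal Hs; inversion Hs; subst; eauto.
Qed.

Theorem theorem2p7 (I O : Type) (P Q R : IA I O)
    (p : state P) (q : state Q) (r : state R) :
  IA_refines (vee p q) r <-> IA_refines p r /\ IA_refines q r.
Proof.
split.
- intros H; split; [exact (IA_refines_vee_l _ _ _ _ _ _ _ _ H)
                   | exact (IA_refines_vee_r _ _ _ _ _ _ _ _ H)].
- intros [Hp Hq]; apply IA_refines_vee; assumption.
Qed.
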